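(* Let $g$ be a connected social network on $N=\{1,\dots,n\}$. Then $g$ is completely informative if and only if, for every pair of distinct individuals $(i,j)$, either $g_{ij}=1$ or there exists an individual $k$ such that $g_{ik}g_{jk}=1$.
   Context: Setting. $N=\{1,\dots,n\}$ is a set of individuals and $g$ is a connected, undirected simple graph on $N$ (the social network); $g_{ij}=1$ if $i,j$ are linked (friends), $g_{ij}=0$ otherwise. Each individual $i$ has a real characteristic $\theta_i$; a realization is a vector $(\theta_1,\dots,\theta_n)$ with pairwise distinct entries. Individual $i$ observes the ordinal comparison between distinct $j$ and $k$ if and only if each of $j,k$ is either $i$ himself or a friend of $i$ in $g$. Types. Given a realization, individual $i$'s type is the matrix $T^i=[t^i_{jk}]$ with $t^i_{jk}=1$ if $i$ observes the comparison between $j$ and $k$ and $\theta_j>\theta_k$, $t^i_{jk}=-1$ if $i$ observes it and $\theta_j<\theta_k$, and $t^i_{jk}=0$ otherwise. Let ${\bf T}=(T^1,\dots,T^n)$. Induced order. Write $i\succ_{\bf T} j$ if there is $k$ with $t^k_{ij}=1$, or there are individuals $i=i^0,\dots,i^M=j$ and $k^0,\dots,k^{M-1}$ with $t^{k^m}_{i^m i^{m+1}}=1$ for all $m=0,\dots,M-1$. The network $g$ is completely informative if, for every realization of the characteristics, $\succ_{\bf T}$ is a complete ranking of $N$ (for all distinct $i,j$, either $i\succ_{\bf T} j$ or $j\succ_{\bf T} i$). *)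

(* Defs.v *)
From mathcomp Require Import all_boot all_order all_algebra.
From mathcomp Require Import reals.

Set Implicit Arguments.
Unset Strict Implicit.
Unset Printing Implicit Defensive.

Import Order.TTheory GRing.Theory Num.Theory.
Local Open Scope ring_scope.

(* Individuals are numbered 0, ..., n-1; [g i j] stands for g_ij = 1. *)

Definition simple_graph (n : nat) (g : rel 'I_n) : Prop :=
  symmetric g /\ irreflexive g.

Definition connected_graph (n : nat) (g : rel 'I_n) : Prop :=
  forall i j : 'I_n, connect g i j.

Definition observes (n : nat) (g : rel 'I_n) (i j k : 'I_n) : bool :=
  [&& j != k, (j == i) || g i j & (k == i) || g i k].

Definition type_matrix (R : realType) (n : nat) (g : rel 'I_n)
    (theta : 'I_n -> R) (i : 'I_n) : 'M[int]_n :=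
  \matrix_(j, k)
    if observes g i j k && (theta j > theta k) then 1
    else if observes g i j k && (theta j < theta k) then -1
    else 0.

(* [T k] is the type of individual [k].  Only the values p 0, ..., p M and
   q 0, ..., q (M-1) of the sequences below matter; 0 < M rules out the
   empty chain from an individual to himself. *)
Definition induced_order (n : nat) (T : 'I_n -> 'M[int]_n) (i j : 'I_n) : Prop :=
  (exists k : 'I_n, T k i j = 1) \/
  (exists (M : nat) (p q : nat -> 'I_n),
     [/\ (0 < M)%N, p 0%N = i, p M = j &
         forall m : nat, (m < M)%N -> T (q m) (p m) (p m.+1) = 1]).

Definition complete_ranking (n : nat) (r : 'I_n -> 'I_n -> Prop) : Prop :=
  forall i j : 'I_n, i <> j -> r i j \/ r j i.

(* A realization is an injective [theta]: its entries are pairwise distinct. *)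
Definition completely_informative (R : realType) (n : nat) (g : rel 'I_n) : Prop :=
  forall theta : 'I_n -> R, injective theta ->
    complete_ranking (induced_order (type_matrix g theta)).

(* Main.v *)
Require Import Defs.
From mathcomp Require Import all_boot all_order all_algebra.
From mathcomp Require Import reals.
From mathcomp Require Import zify.

(** If [i] and [j] take consecutive values, every chain realizing a comparison
    between them collapses to a single step, so some individual observes both;
    that individual is [i], [j] or a common friend.  Hence a non-adjacent pair
    without common friend is left unranked by any realization which makes
    [i] and [j] the two highest individuals. *)

Import Order.TTheory GRing.Theory Num.Theory.

Lemma type_matrix_eq1 (R : realType) (n : nat) (g : rel 'I_n)
    (theta : 'I_n -> R) (k i j : 'I_n) :
  type_matrix g theta k i j = 1%R <->
  observes g k i j /\ (theta j < theta i)%R.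
Proof.
rewrite mxE; split=> [|[-> ->]] //.
by case: observes => //=; case: ltgtP.
Qed.

Lemma chain_lt (R : realType) (n : nat) (g : rel 'I_n) (theta : 'I_n -> R)
    (p q : nat -> 'I_n) (M : nat) :
  0 < M -> (forall m, m < M -> type_matrix g theta (q m) (p m) (p m.+1) = 1%R) ->
  (theta (p M) < theta (p 0))%R.
Proof.
(* The last step is peeled off; a one-step chain is treated apart because the induction hypothesis
   asks for a nonempty chain. *)
elim: M => // [[|M]] IH _ step;
  have /type_matrix_eq1[_ lt_last] := step _ (ltnSn _); first exact: lt_last.
by apply: lt_trans lt_last (IH _ _) => // m lt_m; apply: step; apply: ltnW.
Qed.

Lemma induced_order_lt (R : realType) (n : nat) (g : rel 'I_n)
    (theta : 'I_n -> R) (i j : 'I_n) :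
  induced_order (type_matrix g theta) i j -> (theta j < theta i)%R.
Proof.
case=> [[k /type_matrix_eq1[]] //|[M [p [q [M_gt0 <- <- step]]]]].
exact: chain_lt M_gt0 step.
Qed.

(** In a chain of two or more steps, the value of [p 1] is strictly below that of [i] by the first
    step and strictly above that of [j] by the remaining ones, which the gap forbids. *)
Lemma induced_order_consecutive (R : realType) (n : nat) (g : rel 'I_n)
    (theta : 'I_n -> R) (i j : 'I_n) :
  (forall x, (theta j < theta x)%R -> (theta i <= theta x)%R) ->
  induced_order (type_matrix g theta) i j -> exists k, observes g k i j.
Proof.
move=> gap [[k /type_matrix_eq1[obs _]]|]; first by exists k.
move=> [[|[|M]] [p [q [// _ p0 pM step]]]].
  have /type_matrix_eq1[obs _] := step 0 isT.
  by exists (q 0); rewrite -p0 -pM.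
have /type_matrix_eq1[_ lt_p1] := step 0 isT.
have lt_pM : (theta (p M.+2) < theta (p 1))%R.
  apply: (@chain_lt _ _ g theta (p \o S) (q \o S) M.+1) => // m lt_m.
  exact: step.
by move: (gap (p 1)); rewrite -pM -p0 leNgt lt_p1 => /(_ lt_pM).
Qed.

Lemma observesP (n : nat) (g : rel 'I_n) (i j : 'I_n) :
  simple_graph g -> i <> j ->
  (exists k, observes g k i j) <-> g i j \/ exists k, g i k && g j k.
Proof.
move=> [sym_g _] /eqP neq_ij; rewrite /observes neq_ij /=; split.
  case=> k /andP[/orP[/eqP <-|g_ki] /orP[/eqP jk|g_kj]].
  - by rewrite jk eqxx in neq_ij.
  - by left.
  - by left; rewrite sym_g jk.
  - by right; exists k; rewrite sym_g g_ki sym_g.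
(* Of two friends, [i] himself is an observer. *)
case=> [g_ij|[k /andP[g_ik g_jk]]]; first by exists i; rewrite eqxx g_ij orbT.
by exists k; rewrite !(sym_g k) g_ik g_jk !orbT.
Qed.

(** Indices stay below [n], so the values [n] and [n.+1] are free for [j] and [i]. *)
Definition top_two (R : realType) (n : nat) (i j x : 'I_n) : R :=
  (if x == i then n.+1 else if x == j then n else x)%:R%R.

Lemma top_two_inj (R : realType) (n : nat) (i j : 'I_n) :
  injective (top_two R n i j).
Proof.
move=> x y /eqP; rewrite /top_two eqr_nat => /eqP eq_xy; apply: val_inj.
move: eq_xy (ltn_ord x) (ltn_ord y) => /=.
by do 4?[case: eqP => [->|_]] => //; lia.
Qed.

Lemma top_two_lt (R : realType) (n : nat) (i j : 'I_n) :
  i <> j -> (top_two R n i j j < top_two R n i j i)%R.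
Proof. by rewrite /top_two !eqxx eq_sym => /eqP/negPf ->; rewrite ltr_nat. Qed.

Lemma top_two_gap (R : realType) (n : nat) (i j x : 'I_n) :
  i <> j -> (top_two R n i j j < top_two R n i j x)%R -> x = i.
Proof.
move=> /eqP neq_ij; rewrite /top_two eqxx eq_sym (negPf neq_ij) ltr_nat.
by do 2?case: eqP => // _; rewrite ?ltnn // ltnNge ltnW.
Qed.

Theorem lemma1 (R : realType) (n : nat) (g : rel 'I_n)
    (g_simple : simple_graph g) (g_connected : connected_graph g) :
  completely_informative R g <->
  (forall i j : 'I_n, i <> j -> g i j \/ exists k : 'I_n, g i k && g j k).
Proof.
split=> [informative i j neq_ij|close theta theta_inj i j neq_ij].
  apply/(observesP _ _ _ _ g_simple neq_ij).
  (* Ranking [j] above [i] would contradict the values. In the other case the gap condition holds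
     because only [i] lies above [j]. *)
  case: (informative _ (top_two_inj R n i j) i j neq_ij) => [|/induced_order_lt lt_ij].
    by apply: induced_order_consecutive => x /(top_two_gap _ _ _ _ _ neq_ij) ->.
  by have := lt_trans lt_ij (top_two_lt R n i j neq_ij); rewrite ltxx.
have ranked (x y : 'I_n) : x <> y -> (theta y < theta x)%R ->
    induced_order (type_matrix g theta) x y.
  move=> neq_xy lt_yx.
  have [k obs] := (observesP _ _ _ _ g_simple neq_xy).2 (close x y neq_xy).
  by left; exists k; apply/type_matrix_eq1.
case: (ltgtP (theta i) (theta j)) => [lt_ij|lt_ji|/theta_inj //].
  by right; apply: ranked lt_ij => /esym.
by left; apply: ranked lt_ji.
Qed.
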